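(* There exists a finite group $G$ such that $G\times\mathbb{R}$ appears (up to isomorphism) as a Schützenberger group of $M_{16}(\mathbb{FT})$, but does not appear (up to isomorphism) as a maximal subgroup of $M_{16}(\mathbb{FT})$.
   Context: $\mathbb{FT}=\mathbb{R}$ is the finitary tropical semiring, with $\oplus=\max$ and $\otimes=+$. $M_n(\mathbb{FT})$ is the semigroup of $n\times n$ matrices over $\mathbb{FT}$ under tropical matrix multiplication. A maximal subgroup of a semigroup is an $\mathcal{H}$-class containing an idempotent, equivalently a subgroup maximal under inclusion. In $G\times\mathbb{R}$, $\mathbb{R}$ denotes the additive group of real numbers. For a semigroup (or semigroupoid) $S$, let $S^1$ be obtained by adjoining identities where missing. For $a,b\in S$: $a\mathrel{\mathcal{R}}b$ if $aS^1=bS^1$, $a\mathrel{\mathcal{L}}b$ if $S^1a=S^1b$, and $a\mathrel{\mathcal{H}}b$ if both hold. For an $\mathcal{H}$-class $H$ and $s\in S^1$ such that $sh$ is defined for all $h\in H$ and $sH\subseteq H$, let $\phi_s\colon H\to H$, $a\mapsto sa$. The (left) Schützenberger group of $H$ is $\Gamma_H=\{\phi_s : s\in S^1,\ sH\subseteq H\}$, a group under composition. The Schützenberger groups of $M_{16}(\mathbb{FT})$ are the groups $\Gamma_H$ for $H$ an $\mathcal{H}$-class of $16\times16$ matrices over $\mathbb{FT}$. *)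

(* Defs.v *)
From HB Require Import structures.
From mathcomp Require Import all_boot all_order all_algebra all_fingroup.
From mathcomp Require Import boolp classical_sets functions reals.

Set Implicit Arguments.
Unset Strict Implicit.
Unset Printing Implicit Defensive.

Import Order.TTheory GRing.Theory Num.Theory.

Local Open Scope classical_set_scope.
Local Open Scope ring_scope.

Section TropicalMatrices.
Variables (R : realType) (n : nat).

Definition tropmx : Type := 'M[R]_n.

HB.instance Definition _ := Choice.on tropmx.

(* There is no least element to serve as the default value of the iterated
   maximum, so the term of index [k = i] is used: it is one of those
   being maximised. *)
Definition tropmul (A B : tropmx) : tropmx :=
  \matrix_(i, j) \big[Order.max/A i i + B i j]_(k < n) (A i k + B k j).

Lemma tropmul_leP (A B : tropmx) i j m :
  tropmul A B i j <= m <-> forall k, A i k + B k j <= m.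
Proof.
rewrite mxE; split; first by move/bigmax_leP=> [_ h] k; apply: h.
by move=> h; apply/bigmax_leP; split.
Qed.

Lemma tropmulA : associative tropmul.
Proof.
move=> A B C; apply/matrixP=> i j.
suff h m : tropmul A (tropmul B C) i j <= m <->
           tropmul (tropmul A B) C i j <= m.
  by apply/eqP; rewrite eq_le; apply/andP; split; apply/h.
split=> /tropmul_leP h; apply/tropmul_leP=> k.
- rewrite -lerBrDr; apply/tropmul_leP=> l.
  rewrite lerBrDr -addrA -lerBrDl.
  by move: k; apply/tropmul_leP; rewrite lerBrDl.
- rewrite -lerBrDl; apply/tropmul_leP=> l.
  rewrite lerBrDl addrA -lerBrDr.
  by move: k; apply/tropmul_leP; rewrite lerBrDr.
Qed.

HB.instance Definition _ := isSemigroup.Build tropmx tropmulA.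

End TropicalMatrices.

Section Green.
Variable S : semigroupType.
Implicit Types (a b : S) (H : set S).

Definition has_identity : Prop :=
  exists e : S, left_id e *%g /\ right_id e *%g.

(* [S^1] as a subset of [option S]: [Some s] stands for [s], and [None] is the
   adjoined identity, present only when [S] has none. *)
Definition adjoin1 : set (option S) :=
  [set s | s = None -> ~ has_identity].

Definition act_l (s : option S) a : S := if s is Some s' then (s' * a)%g else a.
Definition act_r a (s : option S) : S := if s is Some s' then (a * s')%g else a.

Definition greenR a b : Prop := act_r a @` adjoin1 = act_r b @` adjoin1.
Definition greenL a b : Prop := act_l^~ a @` adjoin1 = act_l^~ b @` adjoin1.
Definition greenH a b : Prop := greenR a b /\ greenL a b.

Definition is_Hclass H : Prop := exists a, H = [set b | greenH a b].

Definition is_maximal_subgroup H : Prop :=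
  is_Hclass H /\ exists2 e, H e & (e * e)%g = e.

(* The maps [phi_s : H -> H, a |-> s a], for [s] in [S^1] with [s H] in [H]. *)
Definition schutzenberger H : set (H -> H) :=
  [set phi | exists s, [/\ adjoin1 s, act_l s @` H `<=` H
                         & forall a : H, val (phi a) = act_l s (val a)]].

End Green.

Arguments schutzenberger {S} H.

(* The set [A], with the operation [op], is a group isomorphic to [G]. *)
Definition group_iso (G : groupType) (T : Type) (op : T -> T -> T)
    (A : set T) : Prop :=
  exists f : G -> T,
    set_bij [set: G] A f /\ {morph f : x y / (x * y)%g >-> op x y}.

Definition appears_as_maximal_subgroup (G : groupType) (S : semigroupType) :
    Prop :=
  exists H : set S, is_maximal_subgroup H /\ group_iso G *%g H.

Definition appears_as_schutzenberger_group (G : groupType)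
    (S : semigroupType) : Prop :=
  exists H : set S,
    is_Hclass H /\ group_iso G (fun f g : H -> H => f \o g) (schutzenberger H).

(* Main.v *)
Require Import Defs.
From mathcomp Require Import all_boot all_order all_algebra all_fingroup.
From mathcomp Require Import cyclic.
From mathcomp Require Import boolp classical_sets functions reals.
From mathcomp Require Import lra.

(** The group [G] is the automorphism group of the biplane on 11 points whose
    blocks are the translates of the nonzero squares [{1, 3, 4, 5, 9}] modulo
    11; abstractly [G] is PSL(2, 11).  What separates the two kinds of groups
    is the combinatorial structure of which each is a symmetry group.

    The Schutzenberger group of the H-class of a matrix [M] consists of the
    simultaneous symmetries of its rows and of its columns.  When [M] is the
    0/1 incidence matrix of a relation whose rows form an antichain, each row
    is tropically independent of the others, so multiplying by a matrix and
    staying in the H-class can only permute and rescale the rows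
    ([blowup_rows]), and the same holds for columns.  When all row sums and all
    column sums are equal, the rescaling is by a single constant
    ([scaling_const]).  Repeating rows and columns changes nothing, so an
    11 x 11 incidence matrix can be blown up to a 16 x 16 one, and the
    Schutzenberger group is then the product of [R] with the group of row
    permutations that can be undone by column permutations
    ([schutzenberger_blowup]).  It is a symmetry group of a bipartite
    structure: points and blocks are moved by different actions.

    A maximal subgroup has an idempotent [E] for identity, and for [E] rows and
    columns play the same role: both are spanned by those with index in one and
    the same minimal set of indices ([idempotent_basis]).  Each element of the
    subgroup acts there as a permutation together with a scaling
    ([unit_monomial]) that preserves the entries of [E] up to a coboundary.  If
    the subgroup is [G * R] with [G] finite, averaging over [G] removes the
    coboundary, and [G] becomes the full automorphism group of a complete
    digraph, with edges coloured by real numbers, on at most 16 vertices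
    ([maximal_subgroup_colour_autos]).

    The group of the biplane is not of that form ([colour_autos_large]).  An
    element [c] of order 11 must act as a single 11-cycle fixing at most 5
    vertices, and an element normalising [<[c]>] as multiplication by 3 leaves
    only two colours on the cycle, one for square and one for nonsquare
    differences.  If these colours agree, every permutation of the cycle is an
    automorphism, so that [G] has at least 11! elements, whereas it is a proper
    subgroup of the permutations of 11 points.  If they differ, the cycle is
    [G]-stable and carries a Paley tournament; an involution fixes it pointwise
    and hence commutes with [c], which no involution of [G] does. *)

Set Implicit Arguments.
Unset Strict Implicit.
Unset Printing Implicit Defensive.

Import Order.TTheory GRing.Theory Num.Theory.

(** * Tropical products and Green's relations *)

Section Orbits.

Local Open Scope classical_set_scope.

(** A local identity at each element stands in for the identity of [S^1], so that
    principal ideals are compared by genuine multipliers whether or not [S] has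
    an identity of its own. *)
Lemma orbit_eqP (S : semigroupType) (T : Type) (act : option S -> T -> T) :
    (forall x, act None x = x) ->
    (forall x, exists s, act (Some s) x = x) ->
    (forall s s' x, exists s'',
      act (Some s'') x = act (Some s) (act (Some s') x)) ->
  forall x y, act^~ x @` adjoin1 (S := S) = act^~ y @` adjoin1 (S := S) <->
    (exists s, act (Some s) x = y) /\ (exists s, act (Some s) y = x).
Proof.
move=> actN unit comp.
have sub x y : act^~ x @` adjoin1 (S := S) `<=` act^~ y @` adjoin1 (S := S) ->
    exists s, act (Some s) y = x.
  move=> sxy; have [s sx] := unit x.
  have /sxy[[s'|] _ /= <-] : (act^~ x @` adjoin1 (S := S)) x by exists (Some s).
    by exists s'.
  by rewrite actN; apply: unit.
have sup x y : (exists s, act (Some s) y = x) ->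
    act^~ x @` adjoin1 (S := S) `<=` act^~ y @` adjoin1 (S := S).
  case=> s <- _ [[s'|] _ /= <-]; last by rewrite actN; exists (Some s).
  by have [s'' <-] := comp s' s y; exists (Some s'').
move=> x y; split=> [xy|[xy yx]]; first by split; apply: sub; rewrite xy.
by apply/seteqP; split; apply: sup.
Qed.

End Orbits.

Section TropicalProduct.

Local Open Scope ring_scope.

Variables (R : realType) (n : nat).
Implicit Types (A B C : tropmx R n).

Let trE (A : 'M[R]_n) i j : A^T i j = A j i. Proof. by rewrite mxE. Qed.

Let oppE (A : 'M[R]_n) i j : (- A) i j = - A i j. Proof. by rewrite mxE. Qed.

Lemma tropmul_ge A B i j k : A i k + B k j <= (A * B)%g i j.
Proof. by move: k; apply/tropmul_leP. Qed.

Lemma tropmul_attained A B i j : exists k, (A * B)%g i j = A i k + B k j.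
Proof.
have [k _ kmax] := @arg_maxP _ _ _ i xpredT (fun k => A i k + B k j) isT.
exists k; apply/le_anti; rewrite tropmul_ge andbT.
by apply/tropmul_leP => l; apply: kmax.
Qed.

Lemma tropmul_tr A B : ((A * B)%g : tropmx R n)^T = ((B^T : tropmx R n) * A^T)%g.
Proof.
apply/matrixP => i j; rewrite trE; apply/le_anti/andP; split.
  have [k ->] := tropmul_attained A B j i.
  by have := tropmul_ge B^T A^T i j k; rewrite !trE addrC.
have [k ->] := tropmul_attained B^T A^T i j.
by rewrite !trE addrC tropmul_ge.
Qed.

(** Residuation: the entrywise largest [S] with [S * A <= C] is
    [- (A * (- C)^T)^T], and it reaches equality as soon as one row of [A],
    suitably scaled, equals the given row of [C]. *)
Lemma left_divide A C :
    (forall i, exists k c, forall j, C i j = c + A k j) ->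
  exists S : tropmx R n, (S * A)%g = C.
Proof.
move=> rowC; pose N : tropmx R n := (A * ((- C)^T : tropmx R n))%g.
exists (- N^T : 'M_n); apply/matrixP => i j; apply/le_anti/andP; split.
  apply/tropmul_leP => k; rewrite oppE trE.
  by have := tropmul_ge A ((- C)^T : 'M_n) k i j; rewrite trE oppE -/N; lra.
have [k [c Ck]] := rowC i.
apply: le_trans (tropmul_ge _ _ i j k); rewrite oppE trE Ck lerD2r lerNr.
by apply/tropmul_leP => l; rewrite trE oppE Ck; lra.
Qed.

Lemma right_divide A C :
    (forall j, exists k c, forall i, C i j = c + A i k) ->
  exists S : tropmx R n, (A * S)%g = C.
Proof.
move=> colC; have [|S SA] := @left_divide A^T C^T.
  move=> j; have [k [c Ck]] := colC j; exists k, c => i.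
  by rewrite !trE.
by exists S^T; rewrite -[LHS]trmxK tropmul_tr trmxK SA trmxK.
Qed.

Lemma greenLP A B :
  greenL A B <-> (exists S, (S * A)%g = B) /\ (exists S, (S * B)%g = A).
Proof.
apply: (@orbit_eqP _ _ (@act_l (tropmx R n))) => // [C|S S' C].
  by apply: left_divide => i; exists i, 0 => j; rewrite add0r.
by exists (S * S')%g; rewrite /= mulgA.
Qed.

Lemma greenRP A B :
  greenR A B <-> (exists S, (A * S)%g = B) /\ (exists S, (B * S)%g = A).
Proof.
apply: (@orbit_eqP _ _ (fun s C => @act_r (tropmx R n) C s)) => // [C|S S' C].
  by apply: right_divide => i; exists i, 0 => j; rewrite add0r.
by exists (S' * S)%g; rewrite /= mulgA.
Qed.

End TropicalProduct.

(** * Idempotents and their units *)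

Section Basis.

Local Open Scope ring_scope.

(** The set [I] is a minimal set of indices through which every entry of
    [E = E * E] factors.  Minimality gives each index of [I] an entry that
    factors through it alone, and both the vanishing of the diagonal and the
    strict inequality are read off from such an entry. *)
Lemma idempotent_basis (R : realType) n (E : tropmx R n) : (E * E)%g = E ->
  exists I : {set 'I_n},
    [/\ forall i j, exists2 k, k \in I & E i j = E i k + E k j,
        forall i, i \in I -> E i i = 0
      & forall i j, i \in I -> j \in I -> i != j -> E i j + E j i < 0].
Proof.
move=> EE.
have E_ge i j k : E i k + E k j <= E i j by rewrite -[in leRHS]EE tropmul_ge.
pose spans (I : {set 'I_n}) :=
  [forall i, forall j, exists k, (k \in I) && (E i j == E i k + E k j)].
have spansP (I : {set 'I_n}) : reflect
    (forall i j, exists2 k, k \in I & E i j = E i k + E k j) (spans I).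
  apply: (iffP forallP) => [sI i j|sI i].
    by have /forallP/(_ j)/existsP[k /andP[kI /eqP ijk]] := sI i; exists k.
  apply/forallP => j; apply/existsP; have [k kI ijk] := sI i j.
  by exists k; rewrite kI ijk /=.
have spansT : spans [set: 'I_n].
  apply/spansP => i j; have [k] := tropmul_attained E E i j.
  by rewrite EE => ijk; exists k.
have [I /minsetP[/spansP sI minI] _] := minset_exists spansT.
(* By minimality every i in I is the only index of I through which some
   entry E a b factors. *)
have pivot i : i \in I -> exists a b, E a b = E a i + E i b /\
    forall k, k \in I -> k != i -> E a k + E k b < E a b.
  move=> iI; have /forallPn[a /forallPn[b ab]] : ~~ spans (I :\ i).
    apply/negP => /minI/(_ (subsetDl _ _)) DI; move: (iI).
    by rewrite -DI !inE eqxx.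
  have lt_ab k : k \in I -> k != i -> E a k + E k b < E a b.
    move=> kI ki; rewrite lt_neqAle E_ge andbT; apply: contra ab => /eqP abk.
    by apply/existsP; exists k; rewrite !inE ki kI abk /=.
  exists a, b; split=> //; have [k kI abk] := sI a b.
  have [<- //|ki] := eqVneq k i.
  by have := lt_ab k kI ki; rewrite -abk ltxx.
exists I; split=> // [i iI|i j iI jI ij].
  have [a [b [abi lt_ab]]] := pivot i iI; have [k kI aik] := sI a i.
  have [ki|ki] := eqVneq k i; first by rewrite ki in aik; lra.
  by have := lt_ab k kI ki; have := E_ge k b i; lra.
have [a [b [abi lt_ab]]] := pivot i iI.
have := lt_ab j jI; rewrite eq_sym => /(_ ij).
by have := E_ge a j i; have := E_ge j b i; lra.
Qed.

End Basis.

(** The elements of the maximal subgroup at [E] are described by what they do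
    on the basis [I]: a permutation [s] of [I] and a scaling [u]. *)
Section MonomialForm.

Local Open Scope ring_scope.

Variables (R : realType) (n : nat) (E : tropmx R n) (I : {set 'I_n}).
Hypothesis E_span : forall i j, exists2 k, k \in I & E i j = E i k + E k j.
Hypothesis E_diag : forall i, i \in I -> E i i = 0.
Hypothesis E_neg :
  forall i j, i \in I -> j \in I -> i != j -> E i j + E j i < 0.
Hypothesis EE : (E * E)%g = E.

Let T := {i | i \in I}.
Implicit Types (A B : tropmx R n) (s : {perm T}) (u : T -> R).

(** A monomial matrix has entries minus infinity, which are absent from [R], so
    its product with [E], restricted to the rows of the basis, is written out. *)
Definition monomial A s u : Prop :=
  forall (i : T) j, A (val i) j = u i + E (val (s i)) j.

Let E_ge i j k : E i k + E k j <= E i j.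
Proof. by rewrite -[in leRHS]EE tropmul_ge. Qed.

Let E_diagT (i : T) : E (val i) (val i) = 0.
Proof. by rewrite E_diag ?(valP i). Qed.

Let E_antisym (i j : T) : 0 <= E (val i) (val j) + E (val j) (val i) -> i = j.
Proof.
move=> ij; apply/val_inj/eqP; apply: contraLR ij => ij.
by rewrite -ltNge E_neg ?(valP i) ?(valP j).
Qed.

Lemma monomial1 : monomial E 1%g (fun=> 0).
Proof. by move=> i j; rewrite perm1 add0r. Qed.

Lemma monomial_unique A s u s' u' :
  monomial A s u -> monomial A s' u' -> s = s' /\ u =1 u'.
Proof.
move=> As As'.
have ss' : s = s'.
  apply/permP => i; apply: E_antisym.
  have := As i (val (s i)); have := As i (val (s' i)).
  by rewrite !As' !E_diagT; lra.
split=> // i; have := As i (val (s i)).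
by rewrite As' -ss' E_diagT; lra.
Qed.

Lemma monomial_mul A A' s u s' u' : (E * A')%g = A' ->
    monomial A s u -> monomial A' s' u' ->
  monomial (A * A')%g (s * s')%g (fun i => u i + u' (s i)).
Proof.
move=> EA' As As' i j; rewrite permM -addrA -As' -[in RHS]EA'.
apply/le_anti/andP; split.
  have [k ->] := tropmul_attained A A' (val i) j.
  by rewrite As -addrA lerD2l tropmul_ge.
have [k ->] := tropmul_attained E A' (val (s i)) j.
by rewrite addrA -As tropmul_ge.
Qed.

Lemma monomial_determines A A' s u :
    (E * A)%g = A -> (E * A')%g = A' ->
  monomial A s u -> monomial A' s u -> A = A'.
Proof.
have le_rows B B' : (E * B)%g = B -> (E * B')%g = B' ->
    (forall i : T, forall j, B (val i) j = B' (val i) j) ->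
    forall i j, B i j <= B' i j.
  move=> EB EB' BB' i j; rewrite -EB; have [k ->] := tropmul_attained E B i j.
  have [l lI ->] := E_span i k.
  have := tropmul_ge E B' i j l; rewrite EB' -(BB' (Sub l lI) j) /=.
  by have := tropmul_ge E B l j k; rewrite EB; lra.
move=> EA EA' As As'; apply/matrixP => i j; apply/le_anti.
by rewrite !le_rows // => k l; rewrite As As'.
Qed.

(** The diagonal entry [E i i = 0] of [A * B] is attained at some index [f i] of
    the basis.  Two indices with the same image would satisfy
    [E i j + E j i >= 0], so [f] is injective. *)
Lemma unit_monomial A B : (A * B)%g = E -> (B * A)%g = E ->
    (E * A)%g = A -> (A * E)%g = A -> (E * B)%g = B ->
  exists s u, monomial A s u.
Proof.
move=> AB BA EA AE EB.
have split0 (i : T) : exists k : T, A (val i) (val k) + B (val k) (val i) = 0.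
  have AEB : (A * (E * B))%g = E by rewrite EB.
  have [k] := tropmul_attained A (E * B)%g (val i) (val i).
  have [l ->] := tropmul_attained E B k (val i).
  have [m mI ->] := E_span k l; rewrite AEB E_diagT => eq0.
  exists (Sub m mI) => /=; apply/le_anti/andP; split.
    by have := tropmul_ge A B (val i) (val i) m; rewrite AB E_diagT.
  have := tropmul_ge A E (val i) m k; have := tropmul_ge E B m (val i) l.
  by rewrite AE EB; lra.
have [f f0] := choice split0.
have f_inj : injective f.
  move=> i j fij; apply: E_antisym; have := f0 i; have := f0 j.
  have := tropmul_ge A B (val i) (val j) (val (f i)).
  have := tropmul_ge A B (val j) (val i) (val (f i)).
  by rewrite AB fij; lra.
exists (perm f_inj), (fun i => A (val i) (val (f i))) => i j; rewrite permE.
apply/le_anti/andP; split.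
  have := tropmul_ge B A (val (f i)) j (val i).
  by rewrite BA; have := f0 i; lra.
by rewrite -[in leRHS]AE tropmul_ge.
Qed.

(** For [A] alone, [E * A = A] yields one inequality; the other one is the same
    inequality for the inverse [B], whose permutation is inverse to [s]. *)
Lemma unit_monomial_twist A B s u s' u' : (A * B)%g = E -> (B * A)%g = E ->
    (E * A)%g = A -> (E * B)%g = B -> monomial A s u -> monomial B s' u' ->
  forall i j, E (val (s i)) (val (s j)) = E (val i) (val j) + u j - u i.
Proof.
move=> AB BA EA EB As Bs i j.
have twist_ge A' v v' : (E * A')%g = A' -> monomial A' v v' -> forall i j,
    E (val i) (val j) + v' j <= v' i + E (val (v i)) (val (v j)).
  move=> EA' Av x y; rewrite -Av -[in leRHS]EA'.
  apply: le_trans (tropmul_ge _ _ _ _ (val y)).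
  by rewrite Av E_diagT addr0.
have [ss' uu'] : (s * s' = 1)%g /\ forall i, u i + u' (s i) = 0.
  have := monomial_mul EB As Bs; rewrite AB => /monomial_unique.
  by apply; apply: monomial1.
have ss'E x : s' (s x) = x by rewrite -permM ss' perm1.
have := twist_ge _ _ _ EB Bs (s i) (s j); rewrite !ss'E.
have := uu' i; have := uu' j; have := twist_ge _ _ _ EA As i j; lra.
Qed.

(** Rows outside the basis are determined by the equation [E * A = A], so [A] is
    built as a product [P * Q] through the basis; the indices outside the basis
    are sent by [f] to an arbitrary basis index, which only repeats terms of the
    maximum. *)
Lemma monomial_of_twist s u :
    (forall i j, E (val (s i)) (val (s j)) = E (val i) (val j) + u j - u i) ->
  exists A, [/\ (E * A)%g = A, (A * E)%g = A & monomial A s u].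
Proof.
move=> tw.
have [n0|/card_gt0P[i0 _]] := posnP #|'I_n|.
  have no (i : 'I_n) : False by have := fintype0 i n0.
  by exists E; split=> // i; case: (no (val i)).
have [t0I t0II _] := E_span i0 i0; pose t0 : T := Sub t0I t0II.
pose f (k : 'I_n) : T := insubd t0 k.
have fK (i : T) : f (val i) = i by exact: valKd.
pose P : tropmx R n := \matrix_(i, k) E i (val (f k)).
pose Q : tropmx R n := \matrix_(k, j) (u (f k) + E (val (s (f k))) j).
have PE i k : P i k = E i (val (f k)) by rewrite mxE.
have QE k j : Q k j = u (f k) + E (val (s (f k))) j by rewrite mxE.
exists (P * Q)%g; split.
- rewrite mulgA; congr (_ * _)%g; apply/matrixP => i j; apply/le_anti/andP.
  split; last by apply: le_trans (tropmul_ge _ _ _ _ (val (f j)));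
    rewrite !PE E_diagT addr0.
  by have [k ->] := tropmul_attained E P i j; rewrite !PE.
- rewrite -mulgA; congr (_ * _)%g; apply/matrixP => i j; apply/le_anti/andP.
  split; last by apply: le_trans (tropmul_ge _ _ _ _ (val (s (f i))));
    rewrite !QE E_diagT addr0.
  by have [k ->] := tropmul_attained Q E i j; rewrite !QE -addrA lerD2l.
- move=> i j; apply/le_anti/andP; split.
    have [k ->] := tropmul_attained P Q (val i) j; rewrite PE QE.
    by have := E_ge (val (s i)) j (val (s (f k))); rewrite tw; lra.
  apply: le_trans (tropmul_ge _ _ _ _ (val i)).
  by rewrite PE QE fK E_diagT add0r.
Qed.

End MonomialForm.

(** * Maximal subgroups as groups of colour automorphisms *)

Section MaximalSubgroup.

Local Open Scope ring_scope.

(** The colours are the entries of the idempotent [E] on its basis, corrected by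
    the potential [w] that trivialises the scalings of [G].  Conversely a
    permutation preserving them lifts to an element of the subgroup of finite
    order, and [G] contains all elements of finite order of [G * R]. *)
Theorem maximal_subgroup_colour_autos (R : realType) (n : nat)
    (G : finGroupType) (H : set (tropmx R n)) :
    is_Hclass H ->
    group_iso (G * Algebra.to_multiplicative R)%type *%g H ->
  exists (T : finType) (D : T -> T -> R) (rho : G -> {perm T}),
    [/\ (#|T| <= n)%N, {morph rho : x y / (x * y)%g}, injective rho
      & forall pi : {perm T}, (forall x y, D (pi x) (pi y) = D x y) <->
          exists g, rho g = pi].
Proof.
case=> C HC [f [[fH f_inj f_surj] fM]].
have {}f_inj x y : f x = f y -> x = y by apply: f_inj; rewrite inE.
pose E := f 1%g.
have fE x : (E * f x)%g = f x by rewrite -fM mul1g.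
have Ef x : (f x * E)%g = f x by rewrite -fM mulg1.
have EE : (E * E)%g = E := fE 1%g.
have HE (A : tropmx R n) : H A <-> greenH E A.
  have := fH 1%g I; rewrite HC /= /greenH /greenR /greenL => -[-> ->].
  by split=> -[].
have [J [E_span E_diag E_neg]] := idempotent_basis EE.
pose T := {i | i \in J}; pose mono := @monomial R n E J.
have det := monomial_determines E_span.
have uniq := monomial_unique E_diag E_neg.
have mul := @monomial_mul R n E J.
have mono1 : mono E 1%g (fun=> 0) := @monomial1 R n E J.
pose a (g : G) : tropmx R n := f (g, 1%g).
have aM g h : a (g * h)%g = (a g * a h)%g.
  by rewrite -fM; congr (f (_, _)); rewrite mul1g.
have aV g : (a g * a g^-1)%g = E /\ (a g^-1 * a g)%g = E.
  by rewrite -!aM mulgV mulVg.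
have Ea g : (E * a g)%g = a g by exact: fE.
have aE g : (a g * E)%g = a g by exact: Ef.
have /choice[rho /choice[u rho_u]] g : exists s u, mono (a g) s u.
  have [gV Vg] := aV g.
  exact: (unit_monomial E_span E_diag E_neg gV Vg).
have rhoM g h : rho (g * h)%g = (rho g * rho h)%g /\
    forall i, u (g * h)%g i = u g i + u h (rho g i).
  have := rho_u (g * h)%g; rewrite aM => gh.
  exact: (uniq _ _ _ _ _ gh (mul _ _ _ _ _ _ (Ea h) (rho_u g) (rho_u h))).
have rho_tw g i j :
    E (val (rho g i)) (val (rho g j)) = E (val i) (val j) + u g j - u g i.
  have [gV Vg] := aV g.
  exact: (unit_monomial_twist E_diag E_neg gV Vg _ _ (rho_u g) (rho_u g^-1%g)).
(* Averaging the cocycle u over the finite group G makes it a coboundary. *)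
pose w i := #|G|%:R^-1 * \sum_h u h i : R.
have uE g i : u g i = w i - w (rho g i).
  apply/eqP; rewrite eq_sym subr_eq; apply/eqP; rewrite /w.
  rewrite (reindex_inj (mulgI g)) /= (eq_bigr _ (fun h _ => (rhoM g h).2 i)).
  rewrite big_split /= sumr_const mulrDr -[u g i *+ _]mulr_natl mulrA.
  rewrite mulVf ?mul1r //.
  by rewrite pnatr_eq0 -lt0n; apply/card_gt0P; exists 1%g.
pose D (i j : T) := E (val i) (val j) + w j - w i.
exists T, D, rho; split.
- by rewrite card_sig -[leqRHS]card_ord max_card.
- by move=> g h; have [] := rhoM g h.
- move=> g h gh; suff /f_inj[] : a g = a h by [].
  apply: (det _ _ _ _ (Ea g) (Ea h) (rho_u g)).
  by move=> i j; rewrite (rho_u h) !uE gh.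
move=> pi; split=> [piD|[g <-] i j]; last by rewrite /D rho_tw !uE; lra.
pose v (s : {perm T}) i := w i - w (s i).
have exB (s : {perm T}) : (forall i j, D (s i) (s j) = D i j) ->
    exists A, [/\ (E * A)%g = A, (A * E)%g = A & mono A s (v s)].
  move=> sD; apply: monomial_of_twist => // i j.
  by have := sD i j; rewrite /D /v; lra.
have vM (s s' : {perm T}) i : v s i + v s' (s i) = v (s * s')%g i.
  by rewrite /v permM; lra.
have mono_eq A A' s (x x' : T -> R) : (E * A)%g = A -> (E * A')%g = A' ->
    mono A s x -> mono A' s x' -> x =1 x' -> A = A'.
  move=> EA EA' As As' xx'; apply: (det _ _ s x) => // i j.
  by rewrite As' xx'.
have [A [EA AE As]] := exB pi piD.
have [|B [EB BE Bs]] := exB pi^-1%g.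
  by move=> i j; rewrite -[LHS]piD !permKV.
have invE s A1 A2 : (E * A1)%g = A1 -> (E * A2)%g = A2 -> mono A1 s (v s) ->
    mono A2 s^-1%g (v s^-1%g) -> (A1 * A2)%g = E.
  move=> E1 E2 A1s A2s; have := mul _ _ _ _ _ _ E2 A1s A2s; rewrite mulgV => A12.
  apply: (mono_eq _ _ _ _ _ _ EE A12 mono1); first by rewrite mulgA E1.
  by move=> i; rewrite vM mulgV /v perm1 subrr.
have AB := invE _ _ _ EA EB As Bs.
have BA : (B * A)%g = E by apply: (invE pi^-1%g) => //; rewrite ?invgK.
have [x _ xA] : (f @` [set: _])%classic A.
  apply: f_surj; apply/HE; split.
    by apply/greenRP; split; [exists A | exists B].
  by apply/greenLP; split; [exists A | exists B].
have fx : mono (f x) pi (v pi) by rewrite xA.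
have xX m : mono (f (x ^+ m)%g) (pi ^+ m)%g (v (pi ^+ m)%g).
  elim: m => [|m IHm].
    by move=> i j; rewrite /v perm1 subrr add0r.
  rewrite !expgSr fM => i j.
  by rewrite (mul _ _ _ _ _ _ (fE x) IHm fx) vM.
(* The element [x] of [G * R] has finite order, so its real component
   vanishes. *)
have x1 : (x ^+ #[pi])%g = 1%g.
  have := xX #[pi]%g; rewrite expg_order => xpi; apply: f_inj.
  apply: (mono_eq _ _ _ _ _ _ EE xpi mono1); first exact: fE.
  by move=> i; rewrite /v perm1 subrr.
have x2 : x.2 = 0.
  have /(congr1 snd) : (x ^+ #[pi])%g = 1%g := x1.
  have -> m : (x ^+ m)%g.2 = x.2 *+ m :> R.
    by elim: m => // m IHm; rewrite expgS mulrS -IHm.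
  by move/eqP; rewrite [_ == _]mulrn_eq0 -[_ == 0%N]negbK -lt0n order_gt0 => /eqP.
exists x.1; suff axA : a x.1 = A.
  by have := rho_u x.1; rewrite axA => /uniq/(_ As)[].
by rewrite /a -xA; congr f; rewrite [RHS]surjective_pairing x2.
Qed.

End MaximalSubgroup.

(** * Schutzenberger groups of incidence matrices *)

Section RelationAutomorphisms.

Local Open Scope ring_scope.

Variables (T : finType) (a : rel T).

(** The automorphisms of [a], seen as a bipartite graph with its two sides
    kept apart, as permutations of the first side alone. *)
Definition relaut : {set {perm T}} :=
  [set s : {perm T} |
     [exists t : {perm T}, [forall x, forall y, a (s x) y == a x (t y)]]]%SET.

Lemma relautP (s : {perm T}) :
  reflect (exists t : {perm T}, forall x y, a (s x) y = a x (t y))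
          (s \in relaut).
Proof.
rewrite inE; apply: (iffP existsP) => -[t st]; exists t.
  by move=> x y; have /forallP/(_ x)/forallP/(_ y)/eqP := st.
by apply/forallP => x; apply/forallP => y; rewrite st.
Qed.

Lemma group_set_relaut : group_set relaut.
Proof.
apply/group_setP; split=> [|s s' /relautP[t st] /relautP[t' st']].
  by apply/relautP; exists 1%g => x y; rewrite !perm1.
by apply/relautP; exists (t' * t)%g => x y; rewrite !permM st' st.
Qed.

Canonical relaut_group := Group group_set_relaut.

End RelationAutomorphisms.

(** An incidence matrix on [T] is enlarged to an [n] x [n] matrix by repeating
    rows and columns along a surjection [p], of which [q] is a section. *)
Section BlowUp.

Local Open Scope classical_set_scope.
Local Open Scope ring_scope.

Variables (R : realType) (n : nat) (T : finType).
Variables (p : 'I_n -> T) (q : T -> 'I_n).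
Hypothesis qK : cancel q p.

Definition blowup (a : rel T) : tropmx R n := \matrix_(i, j) (a (p i) (p j))%:R.

Lemma blowup_tr (a : rel T) : (blowup a)^T = blowup (fun x y => a y x).
Proof. by apply/matrixP => i j; rewrite !mxE. Qed.

(** An entry 1 of row [x] must be attained by some row [k].  If [p k] were not
    [x], then by the antichain condition row [k] would have a 1 where row [x]
    has a 0, so its coefficient would be at most -1 and could not produce a 1. *)
Lemma row_independent (a : rel T) (x : T) (mu : 'I_n -> R) :
    (forall y z, (forall w, a y w -> a z w) -> y = z) ->
    (exists w, a x w) ->
    (forall k w, mu k + (a (p k) w)%:R <= (a x w)%:R) ->
    (forall w, exists k, (a x w)%:R = mu k + (a (p k) w)%:R) ->
  exists2 k, p k = x & mu k = 0.
Proof.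
move=> antichain [w xw] le_mu att; have [k] := att w; rewrite xw => muk.
have pk : p k = x.
  apply: antichain => v kv; apply: contraT => xv.
  have := le_mu k v; rewrite kv (negbTE xv); move: muk.
  by case: (a (p k) w); rewrite /=; lra.
by exists k => //; move: muk; rewrite pk xw; lra.
Qed.

(** Going from [M] to [C] and back expresses each row of [M] by rows of [M], so
    by independence it passes through a single row of [C], which must be a
    multiple of it. *)
Lemma blowup_rows (a : rel T) (C S S' : tropmx R n) :
    (forall y z, (forall w, a y w -> a z w) -> y = z) ->
    (forall x, exists w, a x w) ->
    (S * blowup a)%g = C -> (S' * C)%g = blowup a ->
    (forall i i' j, p i = p i' -> C i j = C i' j) ->
  exists (s : {perm T}) (u : T -> R),
    forall i j, C i j = u (p i) + (a (s (p i)) (p j))%:R.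
Proof.
set M := blowup a => antichain row_ex SM S'C C_p.
have ME i j : M i j = (a (p i) (p j))%:R by rewrite mxE.
have rowC x : exists k c, forall j, C k j = c + (a x (p j))%:R.
  pose N : tropmx R n := (S' * S)%g.
  have NM : (N * M)%g = M by rewrite -mulgA SM S'C.
  have [|w|l lx] := @row_independent a x (N (q x)) antichain (row_ex x).
  - move=> k w; have := tropmul_ge N M (q x) (q w) k.
    by rewrite NM !ME !qK.
  - have [k] := tropmul_attained N M (q x) (q w).
    by rewrite NM !ME !qK; exists k.
  have [k ->] := tropmul_attained S' S (q x) l => eq0.
  exists k, (S k l) => j; apply/le_anti/andP; split.
    have := tropmul_ge S' C (q x) j k; rewrite S'C ME qK; lra.
  by have := tropmul_ge S M k j l; rewrite SM ME lx.
have [k /choice[c Ck]] := choice rowC.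
have pk_inj : injective (p \o k).
  move=> x y /= kxy.
  have cxy w : c x + (a x w)%:R = c y + (a y w)%:R.
    by rewrite -[w]qK -!Ck; apply: C_p.
  have [w xw] := row_ex x; have [z yz] := row_ex y.
  have c_eq : c x = c y.
    move: (cxy w) (cxy z); rewrite xw yz.
    by case: (a y w); case: (a x z) => /= ? ?; apply/le_anti/andP; split; lra.
  apply: antichain => v xv; apply: contraT => yv.
  by have := cxy v; rewrite xv (negbTE yv) c_eq => /addrI/eqP; rewrite oner_eq0.
exists (perm pk_inj)^-1%g, (fun x => c ((perm pk_inj)^-1%g x)) => i j.
rewrite -Ck; apply: C_p.
by rewrite -[LHS](permKV (perm pk_inj)) permE.
Qed.

Section Regular.

Variables (a : rel T) (r : nat).
Hypothesis row_card : forall x, #|[pred y | a x y]| = r.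
Hypothesis col_card : forall y, #|[pred x | a x y]| = r.
Hypothesis row_inj : forall x y, a x =1 a y -> x = y.
Hypothesis col_inj : forall x y, a^~ x =1 a^~ y -> x = y.
Hypothesis r_gt0 : (0 < r)%N.
Hypothesis T_gt0 : (0 < #|T|)%N.

Let M := blowup a.

Let natr_bool_inj : injective (fun b : bool => b%:R : R).
Proof.
case; case => //= /eqP; first by rewrite oner_eq0.
by rewrite eq_sym oner_eq0.
Qed.

Let ME i j : M i j = (a (p i) (p j))%:R. Proof. by rewrite mxE. Qed.

Let row_antichain y z : (forall w, a y w -> a z w) -> y = z.
Proof.
move=> yz; apply: row_inj.
have sub : [pred w | a y w] \subset [pred w | a z w] by apply/fintype.subsetP.
have /subset_cardP/(_ sub) eqyz : #|[pred w | a y w]| = #|[pred w | a z w]|.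
  by rewrite !row_card.
by move=> w; have := eqyz w.
Qed.

Let col_antichain y z : (forall w, a w y -> a w z) -> y = z.
Proof.
move=> yz; apply: col_inj.
have sub : [pred w | a w y] \subset [pred w | a w z] by apply/fintype.subsetP.
have /subset_cardP/(_ sub) eqyz : #|[pred w | a w y]| = #|[pred w | a w z]|.
  by rewrite !col_card.
by move=> w; have := eqyz w.
Qed.

Let row_ex x : exists w, a x w.
Proof.
by have /card_gt0P[w] : (0 < #|[pred w | a x w]|)%N;
  [rewrite row_card | exists w].
Qed.

Let col_ex x : exists w, a w x.
Proof.
by have /card_gt0P[w] : (0 < #|[pred w | a w x]|)%N;
  [rewrite col_card | exists w].
Qed.

Let sum_card (P : pred T) : \sum_x (P x)%:R = #|[pred x | P x]|%:R :> R.
Proof.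
rewrite -sum1_card natr_sum [RHS]big_mkcond /=.
by apply: eq_bigr => x _; rewrite inE; case: (P x).
Qed.

Let row_sum x : \sum_y (a x y)%:R = r%:R :> R.
Proof. by rewrite sum_card row_card. Qed.

Let col_sum y : \sum_x (a x y)%:R = r%:R :> R.
Proof. by rewrite (sum_card (a^~ y)) col_card. Qed.

(** Summing over [y] computes each [u x] from the total of [v], and summing over
    [x] computes each [v y] from the total of [u]. *)
Let scaling_const (s t : {perm T}) (u v : T -> R) :
    (forall x y, u x + (a (s x) y)%:R = v y + (a x (t y))%:R) ->
  exists l, forall x y, u x = l /\ v y = l.
Proof.
move=> uv.
have rowsum x : #|T|%:R * u x = \sum_y v y.
  have := congr1 (fun F => \sum_y F y) (funext (uv x)).
  rewrite /= !big_split /= sumr_const -[u x *+ _]mulr_natl row_sum.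
  rewrite -(reindex_inj (@perm_inj _ t) (P := xpredT)
    (F := fun y => (a x y)%:R)) /=.
  by rewrite row_sum => /addIr ->.
have colsum y : #|T|%:R * v y = \sum_x u x.
  have := congr1 (fun F => \sum_x F x) (funext (uv^~ y)).
  rewrite /= !big_split /= sumr_const -[v y *+ _]mulr_natl col_sum.
  rewrite -(reindex_inj (@perm_inj _ s) (P := xpredT)
    (F := fun x => (a x y)%:R)) /=.
  by rewrite col_sum => /addIr ->.
have N0 (x : T) : #|T|%:R != 0 :> R.
  by rewrite pnatr_eq0 -lt0n; apply/card_gt0P; exists x.
exists (#|T|%:R^-1 * \sum_y v y) => x y.
split; apply: (mulfI (N0 x)); rewrite (mulVKf (N0 x)) ?rowsum //.
rewrite colsum (eq_bigr (fun=> #|T|%:R^-1 * \sum_y v y)) => [|z _].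
  by rewrite sumr_const -[_ *+ #|_|]mulr_natl (mulVKf (N0 x)).
by rewrite -(rowsum z) (mulKf (N0 x)).
Qed.

Definition row_act (s : {perm T}) (l : R) (B : tropmx R n) : tropmx R n :=
  \matrix_(i, j) (l + B (q (s (p i))) j).

Let row_actE s l B i j : row_act s l B i j = l + B (q (s (p i))) j.
Proof. by rewrite mxE. Qed.

Lemma row_act_mulr s l (B C : tropmx R n) :
  (row_act s l B * C)%g = row_act s l (B * C)%g.
Proof.
apply/matrixP => i j; rewrite row_actE; apply/le_anti/andP; split.
  have [k ->] := tropmul_attained (row_act s l B) C i j.
  by rewrite row_actE -addrA lerD2l tropmul_ge.
have [k ->] := tropmul_attained B C (q (s (p i))) j.
by rewrite addrA -row_actE tropmul_ge.
Qed.

Lemma row_actM s s' l l' (B : tropmx R n) :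
  row_act s l (row_act s' l' B) = row_act (s * s')%g (l + l') B.
Proof. by apply/matrixP => i j; rewrite !row_actE qK permM addrA. Qed.

Let row_act_ME s l i j : row_act s l M i j = l + (a (s (p i)) (p j))%:R.
Proof. by rewrite row_actE ME qK. Qed.

Let H : set (tropmx R n) := [set B | greenH M B].

(** Permuting and rescaling the rows of [M] is a left multiplication by
    residuation, and left multiplications commute with the right multiplication
    by [C]. *)
Lemma row_act_left s l :
  exists S, forall C, (S * (M * C))%g = row_act s l (M * C)%g.
Proof.
have [|S SM] := @left_divide R n M (row_act s l M).
  by move=> i; exists (q (s (p i))), l => j; rewrite row_actE.
by exists S => C; rewrite mulgA SM row_act_mulr.
Qed.

(** For an automorphism, permuting the rows of [M] amounts to permuting its
    columns, which is why the result stays in the R-class of [M]. *)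
Lemma row_act_right s l : s \in relaut a -> exists t, (M * t)%g = row_act s l M.
Proof.
case/relautP => t st; apply: right_divide => j; exists (q (t (p j))), l => i.
by rewrite row_act_ME st ME qK.
Qed.

Let row_act1 : row_act 1 0 M = M.
Proof. by apply/matrixP => i j; rewrite row_act_ME perm1 add0r ME. Qed.

Lemma row_act_Hclass s l B : s \in relaut a -> H B -> H (row_act s l B).
Proof.
move=> sa [/greenRP[[t Mt] [t' Bt']] /greenLP[[S SM] [S' S'B]]].
have [t0 Mt0] := row_act_right l sa.
have [t1 Mt1] := row_act_right (- l) (groupVr sa).
have sB : (M * (t0 * t))%g = row_act s l B by rewrite mulgA Mt0 row_act_mulr Mt.
split.
  apply/greenRP; split; first by exists (t0 * t)%g.
  exists (t' * t1)%g.
  by rewrite mulgA row_act_mulr Bt' row_act_mulr Mt1 row_actM mulgV subrr.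
apply/greenLP; split.
  have [F FM] := row_act_left s l; exists (F * S)%g.
  by rewrite -mulgA SM -Mt FM.
have [F FM] := row_act_left s^-1%g (- l); exists (S' * F)%g.
by rewrite -mulgA -sB FM sB row_actM mulVg addNr -Mt -row_act_mulr row_act1 Mt.
Qed.

(** Rows and columns of [C] are each permuted and rescaled copies of those of
    [M]; comparing the two descriptions makes the scalings constant and the two
    permutations an automorphism of [a]. *)
Lemma Hclass_blowup C : H C -> exists s l, s \in relaut a /\ C = row_act s l M.
Proof.
move=> [/greenRP[[t Mt] [t' Ct']] /greenLP[[S SM] [S' S'C]]].
have C_rows i i' j : p i = p i' -> C i j = C i' j.
  have le_rows k k' : p k = p k' -> C k j <= C k' j.
    move=> kk'; rewrite -Mt; have [x ->] := tropmul_attained M t k j.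
    by rewrite ME kk' -ME tropmul_ge.
  by move=> ii'; apply/le_anti; rewrite !le_rows.
have C_cols i j j' : p j = p j' -> C i j = C i j'.
  have le_cols k k' : p k = p k' -> C i k <= C i k'.
    move=> kk'; rewrite -SM; have [x ->] := tropmul_attained S M i k.
    by rewrite ME kk' -ME tropmul_ge.
  by move=> jj'; apply/le_anti; rewrite !le_cols.
have [s [u Cs]] := blowup_rows row_antichain row_ex SM S'C C_rows.
have [|||||tau [v Ctau]] := @blowup_rows (fun x y => a y x) C^T t^T t'^T.
- exact: col_antichain.
- exact: col_ex.
- by rewrite -blowup_tr -tropmul_tr Mt.
- by rewrite -tropmul_tr Ct' blowup_tr.
- by move=> i i' j ii'; rewrite !mxE; apply: C_cols.
have uv x y : u x + (a (s x) y)%:R = v y + (a x (tau y))%:R.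
  have := Cs (q x) (q y); have := Ctau (q y) (q x).
  by rewrite mxE !qK => -> ->.
have [l lE] := scaling_const uv.
exists s, l; split.
  apply/relautP; exists tau => x y; have [ux vy] := lE x y.
  by have := uv x y; rewrite ux vy => /addrI/natr_bool_inj.
by apply/matrixP => i j; rewrite row_act_ME Cs (lE _ (p j)).1.
Qed.

(** The left action of [S] on the H-class is determined by [S * M], since every
    element of the class is [M * t] for some [t]. *)
Theorem schutzenberger_blowup :
  appears_as_schutzenberger_group
    ((subg_of (relaut_group a) : finGroupType) *
      Algebra.to_multiplicative R)%type (tropmx R n).
Proof.
pose gT : finGroupType := subg_of (relaut_group a).
exists H; split; first by exists M.
pose phi (g : (gT * Algebra.to_multiplicative R)%type) (B : H) : H :=
  exist _ (row_act (sgval g.1) g.2 (val B))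
    (mem_set (row_act_Hclass g.2 (subgP g.1) (set_mem (valP B)))).
have HM : H M by [].
exists phi; split; last first.
  move=> g h; apply/funext => B; apply/val_inj => /=.
  by rewrite row_actM.
split=> [[g l] _|[g l] [g' l'] _ _ eqphi|f [S [_ SH fS]]].
- have [S SM] := row_act_left (sgval g) l.
  exists (Some S); split=> //= [_ [B HB <-]|[B /= HB]].
    have [/greenRP[[t Mt] _] _] := HB; rewrite /= -Mt SM Mt.
    exact: row_act_Hclass (subgP g) HB.
  have [/greenRP[[t Mt] _] _] := set_mem HB.
  by rewrite /= -Mt SM.
- have /(congr1 val)/= eqM :=
    congr1 (fun f => f (exist _ M (mem_set HM))) eqphi.
  have eqMxy x y : l + (a (sgval g x) y)%:R = l' + (a (sgval g' x) y)%:R.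
    have := congr1 (fun B : 'M_n => B (q x) (q y)) eqM.
    by rewrite !row_act_ME !qK.
  have le_l l1 l2 (g1 g2 : gT) : (forall x y,
      l1 + (a (sgval g1 x) y)%:R = l2 + (a (sgval g2 x) y)%:R) -> l1 <= l2 :> R.
    have /card_gt0P[x _] := T_gt0; have [y xy] := row_ex (sgval g1 x).
    by move/(_ x y); rewrite xy; case: (a _ y) => /=; lra.
  have ll' : l = l' by apply/le_anti; rewrite (le_l _ _ _ _ eqMxy) (le_l _ _ g' g).
  congr (_, _) => //; apply/val_inj/permP => x; apply: row_inj => y.
  have := eqMxy x y; rewrite ll' => /addrI.
  exact: natr_bool_inj.
- have /Hclass_blowup[s [l [sa SMs]]] : H (act_l S M) by apply: SH; exists M.
  exists (subg (relaut_group a) s, l) => //.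
  apply/funext => B; apply/val_inj; rewrite fS /= subgK //.
  have [/greenRP[[t Mt] _] _] := set_mem (valP B).
  rewrite -[RHS]/(act_l S (val B)) -[LHS]/(row_act s l (val B)) -Mt -row_act_mulr.
  by rewrite -SMs; case: S {SH fS SMs} => //= S; rewrite mulgA.
Qed.

End Regular.
End BlowUp.

(** * Colour automorphisms on at most 16 vertices *)

Section PrimeCycle.

Local Open Scope group_scope.

(** A second nontrivial orbit would also have [p] elements, and there is no room
    for it. *)
Lemma prime_order_perm (T : finType) (p : nat) (s : {perm T}) (x : T) :
    prime p -> #|T| < p.*2 -> s ^+ p = 1 -> s x != x ->
  #|porbit s x| = p /\ forall y, y \notin porbit s x -> s y = y.
Proof.
move=> p_pr ltTp sp1 sx.
have orb y : s y != y -> #|porbit s y| = p.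
  move=> sy; have := dvdn_orbit 'P <[s]> y.
  have -> : #|<[s]>| = p.
    apply/(prime_nt_dvdP p_pr); last by rewrite order_dvdn sp1.
    by rewrite -[#|_|]/#[s] order_eq1; apply: contraNneq sx => ->; rewrite perm1.
  rewrite -porbitE => dvd; apply/(prime_nt_dvdP p_pr) => //.
  apply: contra_neq sy => /eq_leq/card_le1_eqP eq1.
  by apply: eq1; rewrite ?porbit_id // -{1}(expg1 s) mem_porbit.
split=> [|y yP]; first exact: orb.
apply/eqP/negP => /negP/orb py.
have : #|porbit s x| + #|porbit s y| <= #|T|.
  rewrite -(cardsC (porbit s x)) leq_add2l.
  apply/subset_leq_card/fintype.subsetP => z.
  rewrite inE => zy; apply: contra yP => zx.
  by rewrite -eq_porbit_mem in zx; rewrite -(eqP zx) porbit_sym.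
by rewrite orb // py addnn leqNgt ltTp.
Qed.

End PrimeCycle.

Definition quadres : seq 'Z_11 := [:: 1; 3; 4; 5; 9]%R.

(** -1 is not a square modulo 11; this is what makes the square differences a
    tournament. *)
Lemma quadres_opp (d : 'Z_11) :
  d != 0%R -> ((- d)%R \in quadres) = (d \notin quadres).
Proof. by case: d => [] [|[|[|[|[|[|[|[|[|[|[|//]]]]]]]]]]]. Qed.

Section ColourAutomorphisms.

Local Open Scope group_scope.

Variables (G : finGroupType) (T : finType) (K : eqType) (D : T -> T -> K).
Variables (rho : G -> {perm T}) (c s t : G).
Hypothesis rhoM : {morph rho : x y / x * y}.
Hypothesis rho_inj : injective rho.
Hypothesis rho_im : forall pi : {perm T},
  (forall x y, D (pi x) (pi y) = D x y) <-> exists g, rho g = pi.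
Hypothesis leT16 : #|T| <= 16.
Hypotheses (c_order : #[c] = 11) (c_s : c ^ s = c ^+ 3).
Hypotheses (t_order : t * t = 1) (t_c : t * c != c * t).

Let rho1 : rho 1 = 1.
Proof. by apply: (mulgI (rho 1)); rewrite -rhoM !mulg1. Qed.

Let rhoX g k : rho (g ^+ k) = rho g ^+ k.
Proof. by elim: k => [|k IHk]; rewrite ?rho1 // !expgS rhoM IHk. Qed.

Let rhoD g x y : D (rho g x) (rho g y) = D x y.
Proof. by apply: (rho_im _).2; exists g. Qed.

Let rc11 : rho c ^+ 11 = 1.
Proof. by rewrite -rhoX -c_order expg_order rho1. Qed.

Lemma prime_cycle_moves : exists x, rho c x != x.
Proof.
apply/existsP; apply: contraT => /existsPn /= fixc.
suff c1 : c = 1 by move: c_order; rewrite c1 order1.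
apply: rho_inj; rewrite rho1; apply/permP => x.
by rewrite perm1; apply/eqP; rewrite -[_ == _]negbK fixc.
Qed.

(** The vertices of the cycle through [x0] are labelled by ['Z_11] through [e],
    so that [rho c] becomes [k |-> k + 1]. *)
Section Cycle.

Variable x0 : T.
Hypothesis cx0 : rho c x0 != x0.

Let P := porbit (rho c) x0.
Let e (k : 'Z_11) : T := (rho c ^+ k) x0.

Let cycle_c : #|P| = 11 /\ forall y, y \notin P -> rho c y = y.
Proof. by apply: prime_order_perm => //; apply: leq_ltn_trans leT16 _. Qed.

Let eX m : (rho c ^+ m) x0 = e m%:R%R.
Proof. by rewrite /e Zp_nat /= expg_mod. Qed.

Let eP k : e k \in P.
Proof. exact: mem_porbit. Qed.

Let e_surj x : x \in P -> exists k, x = e k.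
Proof. by case/porbitP => m ->; exists m%:R%R. Qed.

Let e_inj : injective e.
Proof.
have uniqP := uniq_traject_porbit (rho c) x0.
rewrite -/P cycle_c.1 in uniqP.
move=> k l; rewrite /e !permX => ekl; apply/val_inj/eqP.
rewrite -(nth_uniq x0 _ _ uniqP) ?size_traject ?ltn_ord //.
by rewrite !nth_traject ?ltn_ord // ekl.
Qed.

Let cXe m k : (rho c ^+ m) (e k) = e (k + m%:R)%R.
Proof. by rewrite {1}/e -permM -expgD eX natrD natr_Zp. Qed.

Let cXD m x y : D ((rho c ^+ m) x) ((rho c ^+ m) y) = D x y.
Proof. by rewrite -rhoX rhoD. Qed.

Let delta k := D (e 0%R) (e k).

Let D_e i j : D (e i) (e j) = delta (j - i)%R.
Proof. by rewrite /delta -(cXD i (e 0%R)) !cXe natr_Zp add0r subrK. Qed.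

Let cXfix m y : y \notin P -> (rho c ^+ m) y = y.
Proof.
move=> yP; elim: m => [|m IHm]; first by rewrite perm1.
by rewrite expgSr permM IHm cycle_c.2.
Qed.

Let D_out x y f : x \in P -> y \in P -> f \notin P ->
  D x f = D y f /\ D f x = D f y.
Proof.
suff Dout k : f \notin P -> D (e k) f = D x0 f /\ D f (e k) = D f x0.
  by move=> /e_surj[i ->] /e_surj[j ->] /[dup] /(Dout i)[-> ->] /(Dout j)[-> ->].
by move=> fP; rewrite -{1 3}(cXfix k fP) !cXD.
Qed.

(** Since [c ^ s = c ^+ 3], the element [s] acts on the labels as an affine map
    of slope 3. *)
Let delta3 k : delta (3 * k)%R = delta k.
Proof.
have sc m x : rho s ((rho c ^+ m) x) = (rho c ^+ (3 * m)) (rho s x).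
  by rewrite -!rhoX -!permM -!rhoM expgM -c_s -conjXg conjgC.
have /e_surj[m sx0] : rho s x0 \in P.
  apply: contraT => sx0; case/negP: cx0.
  by rewrite -(inj_eq (@perm_inj _ (rho s))) (sc 1%N) cXfix.
have {}sc j : rho s (e j) = e (3 * j + m)%R.
  by rewrite {1}/e sc sx0 cXe natrM natr_Zp addrC.
by rewrite {2}/delta -(rhoD s) !sc D_e mulr0 add0r addrK.
Qed.

(** Multiplication by 3 has two orbits on the nonzero residues, the squares and
    the nonsquares, with representatives 1 and 2. *)
Let deltaE (k : 'Z_11) : k != 0%R ->
  delta k = if k \in quadres then delta 1%R else delta 2%R.
Proof.
have E (j l : 'Z_11) : (3 * j)%R = l -> delta l = delta j.
  by move=> <-; rewrite delta3.
have d3 : delta 3%R = delta 1%R by apply: E; apply/val_inj.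
have d9 : delta 9%R = delta 1%R by rewrite -d3; apply: E; apply/val_inj.
have d5 : delta 5%R = delta 1%R by rewrite -d9; apply: E; apply/val_inj.
have d4 : delta 4%R = delta 1%R by rewrite -d5; apply: E; apply/val_inj.
have d6 : delta 6%R = delta 2%R by apply: E; apply/val_inj.
have d7 : delta 7%R = delta 2%R by rewrite -d6; apply: E; apply/val_inj.
have d10 : delta 10%R = delta 2%R by rewrite -d7; apply: E; apply/val_inj.
have d8 : delta 8%R = delta 2%R by rewrite -d10; apply: E; apply/val_inj.
have : k \in [:: 0; 1; 2; 3; 4; 5; 6; 7; 8; 9; 10]%R.
  by case: k => [] [|[|[|[|[|[|[|[|[|[|[|//]]]]]]]]]]].
rewrite !inE => /orP[-> //|].
do 4! (case/or3P; try by move=> /eqP ->); by case/orP=> /eqP ->.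
Qed.

(** With a single colour on the cycle, any permutation of the cycle is an
    automorphism, because a vertex off the cycle sees all of it in one colour. *)
Let porbit_perm_invariant : delta 1%R = delta 2%R ->
  forall pi, perm_on P pi -> exists g, rho g = pi.
Proof.
move=> d12 pi piP; apply: (rho_im pi).1 => x y.
have D_in z w : z \in P -> w \in P -> z != w -> D z w = delta 1%R.
  move=> /e_surj[i ->] /e_surj[j ->]; rewrite (inj_eq e_inj) D_e => ij.
  by rewrite deltaE ?subr_eq0 1?eq_sym // -d12 if_same.
have [<-|xy] := eqVneq x y.
  have [xP|xP] := boolP (x \in P); last by rewrite !(out_perm piP xP).
  have /e_surj[i ->] : pi x \in P by rewrite perm_closed.
  by case: (e_surj xP) => j ->; rewrite !D_e !subrr.
have [xP|xP] := boolP (x \in P); have [yP|yP] := boolP (y \in P).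
- by rewrite !D_in ?perm_closed // (inj_eq perm_inj).
- by rewrite (out_perm piP yP) (D_out _ xP yP).1 ?perm_closed.
- by rewrite (out_perm piP xP) (D_out _ yP xP).2 ?perm_closed.
- by rewrite !(out_perm piP).
Qed.

(** Suppose that [g] sends a vertex of the cycle to a vertex [f] off it.  As [f]
    sees the cycle in a single colour [kappa], its neighbours of another colour
    on the image of the cycle lie off the cycle too.  There are at least five of
    these, and with [f] they make six vertices where at most five remain. *)
Let porbit_stable : delta 1%R != delta 2%R ->
  forall g x, x \in P -> rho g x \in P.
Proof.
move=> d12 g x /e_surj[i ->]; apply: contraT => fP.
set f := rho g (e i) in fP; pose kappa := D f (e 0%R).
have out k : delta k != kappa -> rho g (e (i + k)%R) \notin P.
  apply: contra => gP; rewrite /kappa -(D_out gP (eP 0%R) fP).2.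
  by rewrite /f rhoD D_e addrC addKr.
have [L uL [sL outL]] : exists2 L : seq 'Z_11, uniq L &
    size L = 6 /\ {in L, forall k, rho g (e (i + k)%R) \notin P}.
  have [dk|dk] := eqVneq (delta 1%R) kappa.
    (* Zero, which labels [f] itself, and the nonsquares. *)
    exists [:: 0; 2; 6; 7; 8; 10]%R; first by [].
    split=> // k; rewrite in_cons => /orP[/eqP ->|kL]; first by rewrite addr0.
    apply: out; rewrite deltaE ?ifN -?dk 1?eq_sym //.
      by move: k kL; apply/allP.
    by move: k kL; apply/allP.
  exists (0 :: quadres)%R; first by [].
  split=> // k; rewrite in_cons => /orP[/eqP ->|kL]; first by rewrite addr0.
  apply: out; rewrite deltaE ?kL //; by move: k kL; apply/allP.
have := leT16; rewrite -(cardsC P) cycle_c.1 leqNgt => /negP[].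
rewrite (@leq_add 11 6) // -sL cardE -(size_map (fun k => rho g (e (i + k)%R))).
apply: uniq_leq_size => [|y /mapP[k kL ->]].
  by rewrite map_inj_uniq // => k l /perm_inj /e_inj /addrI.
by rewrite mem_enum inE outL.
Qed.

Lemma cycle_autos_large : #|{perm 'Z_11}| <= #|G|.
Proof.
have [d12|d12] := eqVneq (delta 1%R) (delta 2%R).
  have /subset_leq_card : [set pi | perm_on P pi] \subset rho @: [set: G].
    apply/fintype.subsetP => pi; rewrite inE => /(porbit_perm_invariant d12)[g <-].
    exact: imset_f.
  rewrite cardsE card_perm card_imset // cardsT => ?.
  rewrite -cardsT (eq_card (B := perm_on [set: 'Z_11])).
    by rewrite card_perm cardsT card_ord -[in X in X`!]cycle_c.1.
  by move=> pi; rewrite inE; apply/esym/fintype.subsetP => x; rewrite inE.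
(* [t] fixes the cycle pointwise and [c] fixes its complement pointwise, so the
   two commute. *)
case/eqP: t_c; apply: rho_inj; apply/permP => x; rewrite !rhoM !permM.
have t_inv y : rho t (rho t y) = y by rewrite -permM -rhoM t_order rho1 perm1.
have [xP|xP] := boolP (x \in P); last first.
  rewrite (cycle_c.2 x) // cycle_c.2 //; apply: contra xP => txP.
  by rewrite -(t_inv x); exact: porbit_stable.
suff tP y : y \in P -> rho t y = y.
  by rewrite !tP //; have /e_surj[k ->] := xP; rewrite -[rho c]expg1 cXe eP.
move=> yP; have [k yk] := e_surj yP.
have [l tk] := e_surj (porbit_stable d12 t (eP k)).
have tl : rho t (e l) = e k by rewrite -tk t_inv.
rewrite yk tk; congr e; apply/eqP; apply: contraR d12 => kl.
have d0 : (l - k)%R != 0%R by rewrite subr_eq0.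
have dN0 : (- (l - k))%R != 0%R by rewrite oppr_eq0.
have := rhoD t (e k) (e l); rewrite tk tl !D_e -[(k - l)%R]opprB.
rewrite (deltaE d0) (deltaE dN0) quadres_opp //.
by case: (_ \in quadres) => /= ->.
Qed.

End Cycle.

(** The hypotheses on [c], [s] and [t] hold in the group of the biplane, whose
    order is less than 11!, so that group is not the full group of colour
    automorphisms of any [D]. *)
Lemma colour_autos_large : #|{perm 'Z_11}| <= #|G|.
Proof. by have [x0 /cycle_autos_large] := prime_cycle_moves. Qed.

End ColourAutomorphisms.

(** * The biplane on 11 points *)

Local Open Scope ring_scope.

(** The point [x] lies on the block [y], which is the translate of the nonzero
    squares by [y]. *)
Definition paley : rel 'Z_11 := fun x y => x - y \in quadres.

Lemma card_quadres : #|[pred k | k \in quadres]| = 5%N.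
Proof.
have -> : #|[pred k | k \in quadres]| = #|quadres| by apply: eq_card.
by have /card_uniqP -> : uniq quadres by [].
Qed.

Lemma paley_row_card x : #|[pred y | paley x y]| = 5%N.
Proof.
apply: etrans card_quadres; rewrite -!sum1_card (reindex_inj (subrI x)).
by apply: eq_bigl => y; rewrite inE /= /paley subKr !inE.
Qed.

Lemma paley_col_card y : #|[pred x | paley x y]| = 5%N.
Proof.
apply: etrans card_quadres; rewrite -!sum1_card (reindex_inj (addIr y)).
by apply: eq_bigl => x; rewrite inE /= /paley addrK !inE.
Qed.

(** The blocks are pairwise distinct: no nonzero translation preserves the
    squares. *)
Lemma quadres_shift (d : 'Z_11) :
  {in quadres, forall k, d + k \in quadres} -> d = 0.
Proof.
move=> dQ; apply: contraTeq isT => d0.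
suff : ~~ all (fun k => d + k \in quadres) quadres by move/allP.
by case: d d0 {dQ} => [] [|[|[|[|[|[|[|[|[|[|[|//]]]]]]]]]]] i //; vm_compute.
Qed.

Lemma paley_row_inj x y : paley x =1 paley y -> x = y.
Proof.
move=> xy; apply/subr0_eq/quadres_shift => k kQ.
have := xy (y - k); rewrite /paley opprB addrCA [_ + (k - _)]addrCA subrr.
by rewrite addr0 addrC => ->.
Qed.

Lemma paley_col_inj x y : paley^~ x =1 paley^~ y -> x = y.
Proof.
move=> xy; apply/subr0_eq/quadres_shift => k kQ.
by have := xy (x + k); rewrite /paley addrAC subrr add0r kQ addrAC => <-.
Qed.

(** Exchanging 0 and 1 turns the block [{1, 3, 4, 5, 9}] into
    [{0, 3, 4, 5, 9}], which is not a translate of the squares. *)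
Lemma tperm_notin_relaut_paley : tperm 0 1 \notin relaut paley.
Proof.
apply/relautP => -[t /(_ _ 0)]; rewrite /paley => st.
have : all (fun x => x - t 0 \in quadres) [:: 0; 3; 4; 5; 9].
  by rewrite /= -!st tpermL !tpermD.
apply/negP; case: {st}(t 0) => [] [|[|[|[|[|[|[|[|[|[|[|//]]]]]]]]]]] i;
by vm_compute.
Qed.

Definition translation : {perm 'Z_11} := perm (addIr (1 : 'Z_11)).

Lemma mul3_inj : injective (fun x : 'Z_11 => x * 3).
Proof.
apply: (can_inj (g := fun x => x * 4)) => x; rewrite -mulrA -[RHS]mulr1.
by congr (_ * _); apply/val_inj.
Qed.

Definition dilation : {perm 'Z_11} := perm mul3_inj.

(** An involutive automorphism of the biplane that comes from no affine map of
    ['Z_11]; it moves points by [flip_points] and blocks by [flip_blocks]. *)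
Definition flip_points (x : 'Z_11) : 'Z_11 :=
  nth 0 [:: 0; 1; 5; 3; 7; 2; 8; 4; 6; 10; 9] x.

Definition flip_blocks (y : 'Z_11) : 'Z_11 :=
  nth 0 [:: 9; 4; 10; 3; 1; 5; 6; 8; 7; 0; 2] y.

Lemma flip_pointsK : involutive flip_points.
Proof.
by case=> [] [|[|[|[|[|[|[|[|[|[|[|//]]]]]]]]]]] i; apply/val_inj.
Qed.

Lemma flip_blocksK : involutive flip_blocks.
Proof.
by case=> [] [|[|[|[|[|[|[|[|[|[|[|//]]]]]]]]]]] i; apply/val_inj.
Qed.

Definition flip : {perm 'Z_11} := perm (inv_inj flip_pointsK).

Lemma translationX k x : (translation ^+ k)%g x = x + k%:R.
Proof.
elim: k => [|k IHk]; first by rewrite perm1 addr0.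
by rewrite expgSr permM IHk permE -addrA -natr1.
Qed.

Lemma translation_relaut : translation \in relaut paley.
Proof.
apply/relautP; exists translation^-1%g => x y; rewrite permE /paley.
set z := (translation^-1)%g y.
have -> : y = z + 1 by rewrite -[LHS](permKV translation) permE.
by rewrite opprD addrACA subrr addr0.
Qed.

Lemma quadres3 k : (k * 3 \in quadres) = (k \in quadres).
Proof. by case: k => [] [|[|[|[|[|[|[|[|[|[|[|//]]]]]]]]]]]. Qed.

Lemma dilation_relaut : dilation \in relaut paley.
Proof.
apply/relautP; exists dilation^-1%g => x y; rewrite permE /paley.
set z := (dilation^-1)%g y.
have -> : y = z * 3 by rewrite -[LHS](permKV dilation) permE.
by rewrite -mulrBl quadres3.
Qed.

Lemma flip_relaut : flip \in relaut paley.
Proof.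
apply/relautP; exists (perm (inv_inj flip_blocksK)) => x y; rewrite !permE.
rewrite /paley.
by case: x => [] [|[|[|[|[|[|[|[|[|[|[|//]]]]]]]]]]] i;
   case: y => [] [|[|[|[|[|[|[|[|[|[|[|//]]]]]]]]]]] j.
Qed.

Lemma flip_translation : (flip * translation != translation * flip)%g.
Proof.
by apply/eqP => /permP/(_ 1)/(congr1 val); rewrite !permM !permE.
Qed.

Lemma translation_order : #[translation]%g = 11%N.
Proof.
apply: nt_prime_order => //.
  apply/permP => x; rewrite translationX perm1 -[RHS]addr0.
  by congr (_ + _); apply/val_inj.
by apply/eqP => /permP/(_ 0); rewrite permE perm1.
Qed.

Lemma translation_dilation : (translation ^ dilation = translation ^+ 3)%g.
Proof.
apply: (mulgI dilation); rewrite -conjgC.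
by apply/permP => x; rewrite permM [RHS]permM translationX !permE mulrDl mul1r.
Qed.

Lemma flipK : (flip * flip = 1)%g.
Proof. by apply/permP => x; rewrite permM !permE flip_pointsK. Qed.

Theorem corollary7p12 (R : realType) :
  exists G : finGroupType,
    appears_as_schutzenberger_group
      (G * Algebra.to_multiplicative R)%type (tropmx R 16) /\
    ~ appears_as_maximal_subgroup
        (G * Algebra.to_multiplicative R)%type (tropmx R 16).
Proof.
pose A := relaut_group paley.
exists (subg_of A : finGroupType); split.
  pose p (i : 'I_16) : 'Z_11 := i%:R; pose q (x : 'Z_11) : 'I_16 := inord x.
  have qK : cancel q p.
    by move=> x; rewrite /p inordK ?natr_Zp // (ltn_trans (ltn_ord x)).
  apply: (schutzenberger_blowup R qK paley_row_card paley_col_card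
            paley_row_inj paley_col_inj); by rewrite ?card_ord.
case=> H [[Hclass _] iso].
have [T [D [rho [leT rhoM rho_inj rho_im]]]] :=
  maximal_subgroup_colour_autos Hclass iso.
have [Ac As At] := And3 translation_relaut dilation_relaut flip_relaut.
pose c := subg A translation; pose s := subg A dilation; pose t := subg A flip.
have c_order : #[c]%g = 11%N.
  by rewrite order_injm ?injm_subg ?translation_order.
have c_s : (c ^ s = c ^+ 3)%g.
  by rewrite -morphJ // -morphX // translation_dilation.
have tt : (t * t = 1)%g by rewrite -morphM // flipK morph1.
have tc : (t * c != c * t)%g.
  apply: contra flip_translation; rewrite -!morphM // => /eqP.
  by move/(injmP (injm_subg A)) => ->; rewrite ?groupM.
have := colour_autos_large rhoM rho_inj rho_im leT c_order c_s tt tc.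
have -> : #|subg_of A| = #|relaut paley|.
  by rewrite -cardsT -(card_injm (injm_subg A) (subxx A)) im_subg.
rewrite leqNgt => /negP[].
rewrite -cardsT; apply: proper_card.
rewrite properE finset.subsetT; apply/fintype.subsetPn; exists (tperm 0 1) => //.
exact: tperm_notin_relaut_paley.
Qed.
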